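(* Let $n\ge 2$ and let $\mathcal{M}_n$ be the following set of polynomials of degree $n$: if $n=2m$ with $m\ge1$, $\mathcal{M}_n$ consists of all $z^{2m}+e^{i2\theta}z$ with $\theta\in\mathbb{R}$; if $n=2m+1$ with $m\ge 1$, $\mathcal{M}_n$ consists of all $z^{2m+1}+\lambda e^{i\theta}z^{m+1}+e^{i2\theta}z$ with $\lambda,\theta\in\mathbb{R}$ and $|\lambda|\le\frac{2\sqrt{2m+1}}{m+1}$. If $p\in\mathcal{M}_n$, then there exists $\varepsilon>0$ such that for every $q\in S(n,0)$ with $\Delta(q,p)<\varepsilon$ one has $d(q)\le\left(\frac1n\right)^{\frac{1}{n-1}}$. Moreover, the latter inequality is strict unless $q\in\mathcal{M}_n$.
   Context: For a polynomial $p$, $Z(p)$ denotes its set of complex zeros. $S(n,0)$ is the set of all monic complex polynomials of degree $n$ having all their zeros in the closed unit disk and having at least one zero at $0$. For monic polynomials $p(z)=\prod_{i=1}^n(z-z_i)$ and $q(z)=\prod_{i=1}^n(z-\zeta_i)$ of degree $n$, $\Delta(p,q)=\min_{\sigma\in\Sigma_n}\max_{1\le i\le n}|z_i-\zeta_{\sigma(i)}|$, where $\Sigma_n$ is the symmetric group on $n$ elements. For a monic polynomial $p$ of degree $n\ge 2$ with all zeros in the closed unit disk, $d(p)=\max_{z\in Z(p)}\min_{w\in Z(p')}|z-w|$. *)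

(* Defs.v *)
From HB Require Import structures.
From mathcomp Require Import all_boot all_order all_algebra all_fingroup.
From mathcomp Require Import all_classical all_reals all_analysis.
From mathcomp.real_closed Require Export complex.

Set Implicit Arguments.
Unset Strict Implicit.
Unset Printing Implicit Defensive.

Import Order.TTheory GRing.Theory Num.Theory.
Export ComplexField.Normc.

Local Open Scope ring_scope.
Local Open Scope complex_scope.

Section Defs.
Variable R : realType.
Implicit Types (p q : {poly R[i]}) (s : seq R) (x y : R) (n : nat).

(* The value 0 on the empty sequence is a junk value. *)
Definition seq_max s : R := if s is x :: t then \big[Num.max/x]_(y <- t) y else 0.
Definition seq_min s : R := if s is x :: t then \big[Num.min/x]_(y <- t) y else 0.

(* Listed with multiplicity, in an arbitrary but fixed order. *)
Definition zeros p : seq R[i] := sval (closed_field_poly_normal p).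

Definition expi x : R[i] := cos x +i* sin x.

Definition inS0 n p : Prop :=
  [/\ p \is monic, size p = n.+1, forall z, root p z -> normc z <= 1 & root p 0].

(* Meant for monic p and q of degree n, so that both lists of zeros have
   size n. *)
Definition Delta n p q : R :=
  seq_min [seq seq_max [seq normc ((zeros p)`_i - (zeros q)`_(s i)) | i : 'I_n]
          | s : 'S_n].

Definition d p : R :=
  seq_max [seq seq_min [seq normc (z - w) | w <- zeros p^`()] | z <- zeros p].

Definition inM n p : Prop :=
  (exists m, [/\ (1 <= m)%N, n = (2 * m)%N &
     exists theta : R, p = 'X^(2 * m) + expi (2 * theta) *: 'X])
  \/
  (exists m, [/\ (1 <= m)%N, n = (2 * m + 1)%N &
     exists lambda theta : R,
       `|lambda| <= 2 * Num.sqrt (2 * m + 1)%:R / (m + 1)%:R /\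
       p = 'X^(2 * m + 1) + (lambda%:C * expi theta) *: 'X^(m + 1)
           + expi (2 * theta) *: 'X]).

Lemma zeros_spec p : p = lead_coef p *: \prod_(z <- zeros p) ('X - z%:P).
Proof. by rewrite /zeros; case: closed_field_poly_normal. Qed.

Lemma mem_zeros p z : p != 0 -> (z \in zeros p) = root p z.
Proof.
move=> p0; rewrite [in RHS](zeros_spec p) rootZ ?lead_coef_eq0//.
by rewrite root_prod_XsubC.
Qed.

Lemma size_zeros p : p != 0 -> size (zeros p) = (size p).-1.
Proof.
move=> p0; rewrite [in RHS](zeros_spec p) size_scale ?lead_coef_eq0//.
by rewrite size_prod_XsubC.
Qed.

Lemma seq_maxP s : s != [::] ->
  seq_max s \in s /\ (forall x, x \in s -> x <= seq_max s).
Proof.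
case: s => // x t _ /=; elim: t => [|y t [IH1 IH2]].
  by rewrite big_nil; split=> [|z]; rewrite ?mem_seq1// => /eqP ->.
rewrite big_cons; split.
  by rewrite maxEle; case: ifP => _; move: IH1; rewrite !inE;
    do ?[case/orP=> ->]; rewrite ?eqxx ?orbT.
by move=> z; rewrite !inE => /or3P[/eqP->|/eqP->|zt];
  rewrite le_max ?lexx// IH2 ?inE ?eqxx ?zt ?orbT.
Qed.

Lemma seq_minP s : s != [::] ->
  seq_min s \in s /\ (forall x, x \in s -> seq_min s <= x).
Proof.
case: s => // x t _ /=; elim: t => [|y t [IH1 IH2]].
  by rewrite big_nil; split=> [|z]; rewrite ?mem_seq1// => /eqP ->.
rewrite big_cons; split.
  by rewrite minEle; case: ifP => _; move: IH1; rewrite !inE;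
    do ?[case/orP=> ->]; rewrite ?eqxx ?orbT.
by move=> z; rewrite !inE => /or3P[/eqP->|/eqP->|zt];
  rewrite ge_min ?lexx// IH2 ?inE ?eqxx ?zt ?orbT.
Qed.

End Defs.

(* Main.v *)
(* Let r = n^(-1/(n-1)) and let q be in S(n,0). The product of the moduli of
   the critical points of q is 1/n times that of its nonzero zeros, hence at
   most r^(n-1), so 0 is within r of a critical point. If no critical point is
   closer, then all nonzero zeros lie on the unit circle and all critical
   points on the circle of radius r. Then q/z and q' are both self-inversive;
   comparing the moduli of their coefficients (k+1) g_k and g_k, strict
   concavity of log((k+1)/(n-k)) kills all g_k but the two extreme ones and the
   middle one, and q is in M_n.

   For n >= 4, every nonzero zero z of p in M_n has a critical point strictly
   within r: it is of the form z t with t^(n-1) = 1/n (n even) or t^m prescribed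
   (n = 2m+1) and Re t > 1/2. This persists under perturbation. For n = 3 and
   lambda = +- sqrt 3 the three zeros form an equilateral triangle, with equality
   at each of them, so perturbation does not suffice; instead, for every q in
   S(3,0) and every nonzero zero a, the quantities u, v = (a - w_i)/a satisfy
   3(u+v) = 2+6uv, so that they cannot both lie outside the circle of radius
   1/sqrt 3. The case n = 2 is immediate. *)
Require Import Defs.
From mathcomp Require Import all_boot all_order all_algebra all_fingroup.
From mathcomp Require Import all_classical all_reals all_analysis.
From mathcomp Require Import ring lra zify.

Set Implicit Arguments.
Unset Strict Implicit.
Unset Printing Implicit Defensive.

Import Order.TTheory GRing.Theory Num.Theory.
Local Open Scope ring_scope.

(** * Complex modulus *)

Lemma normcX (R : realType) (z : R[i]) k : normc (z ^+ k) = normc z ^+ k.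
Proof. by elim: k => [|k IH]; rewrite ?expr0 ?normc1// !exprS normcM IH. Qed.

Lemma normc_ge0 (R : realType) (z : R[i]) : 0 <= normc z.
Proof. by case: z => a b; apply: sqrtr_ge0. Qed.

Lemma normc_gt0 (R : realType) (z : R[i]) : (0 < normc z) = (z != 0).
Proof.
rewrite lt_def normc_ge0 andbT; congr (~~ _).
by apply/eqP/eqP => [/eq0_normc//|->]; exact: normc0.
Qed.

Lemma normc_opp (R : realType) (z : R[i]) : normc (- z) = normc z.
Proof. exact: normcN. Qed.

Lemma normcD_le (R : realType) (x y : R[i]) :
  normc (x + y) <= normc x + normc y.
Proof. exact: le_normcD. Qed.

Lemma normc_dist_trans (R : realType) (y x z : R[i]) :
  normc (x - z) <= normc (x - y) + normc (y - z).
Proof.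
have -> : x - z = (x - y) + (y - z) by rewrite addrA subrK.
exact: normcD_le.
Qed.

Lemma normc_distC (R : realType) (x y : R[i]) : normc (x - y) = normc (y - x).
Proof. by rewrite -normc_opp opprB. Qed.

Lemma sqr_normc_ReIm (R : realType) (z : R[i]) :
  normc z ^+ 2 = complex.Re z ^+ 2 + complex.Im z ^+ 2.
Proof. by case: z => a b /=; rewrite sqr_sqrtr// addr_ge0// sqr_ge0. Qed.

Lemma mulc_conj (R : realType) (z : R[i]) : z * z^* = (normc z ^+ 2)%:C%C.
Proof.
rewrite sqr_normc_ReIm; case: z => a b; rewrite /Num.conj/=.
apply/eqP; rewrite eq_complex /=.
by apply/andP; split; apply/eqP; ring.
Qed.

Lemma normc_conj (R : realType) (z : R[i]) : normc z^* = normc z.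
Proof. by case: z => a b; rewrite /Num.conj/= sqrrN. Qed.

Lemma normc_real (R : realType) (x : R) : normc x%:C%C = `|x|.
Proof. by rewrite /= expr0n/= addr0 sqrtr_sqr. Qed.

Lemma normc_nat (R : realType) k : normc (k%:R : R[i]) = k%:R.
Proof.
have -> : (k%:R : R[i]) = (k%:R : R)%:C%C by rewrite rmorph_nat.
by rewrite normc_real ger0_norm// ler0n.
Qed.

Lemma normc_prod (R : realType) (I : Type) (s : seq I) (F : I -> R[i]) :
  normc (\prod_(i <- s) F i) = \prod_(i <- s) normc (F i).
Proof.
elim: s => [|x s IH]; first by rewrite !big_nil normc1.
by rewrite !big_cons normcM IH.
Qed.

Lemma normc_expi (R : realType) (x : R) : normc (expi x) = 1.
Proof. by rewrite /= cos2Dsin2 sqrtr1. Qed.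

Lemma expiD (R : realType) (x y : R) : expi (x + y) = expi x * expi y.
Proof.
by rewrite /expi cosD sinD; apply/eqP; rewrite eq_complex /= eqxx addrC eqxx.
Qed.

Lemma expi2 (R : realType) (x : R) : expi (2 * x) = expi x ^+ 2.
Proof. by rewrite mulr2n mulrDl !mul1r expiD -expr2. Qed.

Lemma expiX (R : realType) (x : R) k : expi x ^+ k = expi (k%:R * x).
Proof.
elim: k => [|k IH]; last by rewrite exprS IH -expiD -mulr_natl -natr1; congr expi; ring.
by rewrite expr0 mul0r /expi cos0 sin0.
Qed.

(** The bound on [t] matters in [rootc_near_real], where the argument is divided by [m]. *)
Lemma expi_surj (R : realType) (u : R[i]) :
  normc u = 1 -> exists2 t : R, `|t| <= pi & u = expi t.
Proof.
move=> nu; have := sqr_normc_ReIm u; rewrite nu expr1n.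
case: u {nu} => a b /= ab.
have ha : -1 <= a <= 1 by apply/andP; split; nra.
have hs : Num.sqrt (1 - a ^+ 2) = `|b|.
  by rewrite -sqrtr_sqr; congr Num.sqrt; lra.
have aE : `|acos a| <= pi by rewrite ger0_norm ?acos_ge0 ?acos_lepi.
have [b0|b0] := leP 0 b.
  exists (acos a) => //; rewrite /expi acosK ?in_itv//= sin_acos// hs ger0_norm//.
exists (- acos a); first by rewrite normrN.
rewrite /expi cosN sinN acosK ?in_itv//= sin_acos// hs.
by rewrite ltr0_norm// opprK.
Qed.

Lemma expi_neq0 (R : realType) (x : R) : expi x != 0.
Proof. by rewrite -normc_gt0 normc_expi. Qed.

(** * The critical radius and equality cases for products of reals *)

Definition crit_radius {R : realType} (n : nat) : R :=
  (n%:R^-1) `^ ((n.-1)%:R^-1).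

Lemma crit_radius_gt0 (R : realType) n : (2 <= n)%N -> 0 < crit_radius n :> R.
Proof. by move=> hn; rewrite powR_gt0 ?invr_gt0 ?ltr0n//; lia. Qed.

Lemma crit_radiusX (R : realType) n : (2 <= n)%N -> crit_radius n ^+ n.-1 = n%:R^-1 :> R.
Proof.
move=> hn; rewrite /crit_radius -powR_mulrn ?powR_ge0// -powRrM mulVf ?powRr1//.
by rewrite pnatr_eq0; lia.
Qed.

Lemma prod_le1_eq1 (R : realType) (I : eqType) (s : seq I) (F : I -> R) :
  (forall i, i \in s -> 0 <= F i <= 1) ->
  \prod_(i <- s) F i <= 1 /\
  (1 <= \prod_(i <- s) F i -> forall i, i \in s -> F i = 1).
Proof.
elim: s => [|x s IH] h; first by rewrite big_nil.
have [|p1 p2] := IH; first by move=> i si; apply: h; rewrite inE si orbT.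
have /andP[x0 x1] := h x (mem_head _ _).
have p0 : 0 <= \prod_(i <- s) F i.
  rewrite big_seq; apply: prodr_ge0 => i si.
  by have /andP[] : 0 <= F i <= 1 by apply: h; rewrite inE si orbT.
rewrite big_cons; split; first by nra.
move=> le1 i; rewrite inE => /predU1P[->|]; first by nra.
by apply: p2; nra.
Qed.

Lemma prod_ge_exp (R : realType) (I : eqType) (s : seq I) (F : I -> R) (r : R) :
  0 <= r -> (forall i, i \in s -> r <= F i) ->
  r ^+ size s <= \prod_(i <- s) F i.
Proof.
move=> r0; elim: s => [|x s IH] h; first by rewrite big_nil expr0.
rewrite big_cons /= exprS ler_pM ?exprn_ge0 ?h ?mem_head//.
by apply: IH => i si; apply: h; rewrite inE si orbT.
Qed.

Lemma prod_eq_exp (R : realType) (I : eqType) (s : seq I) (F : I -> R) (r : R) :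
  0 < r -> (forall i, i \in s -> r <= F i) ->
  \prod_(i <- s) F i <= r ^+ size s ->
  forall i, i \in s -> F i = r.
Proof.
move=> r0; elim: s => [|x s IH] h //=; rewrite big_cons exprS => hp.
have hx : r <= F x by apply: h; rewrite mem_head.
have hs i : i \in s -> r <= F i by move=> si; apply: h; rewrite inE si orbT.
have p1 : r ^+ size s <= \prod_(i <- s) F i by apply: prod_ge_exp => //; exact: ltW.
have p0 : 0 < r ^+ size s by rewrite exprn_gt0.
move=> i; rewrite inE => /predU1P[->|si]; first by nra.
by apply: IH => //; nra.
Qed.

(** * Critical points of polynomials in S(n,0) *)

Section DirectedDistance.
Variable R : realType.
Implicit Types (p q : {poly R[i]}) (r : R).

(** The maximum in [d] is attained at some zero [z], and the minimum there is at most the distance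
    from [z] to any critical point [w]. The predicate [P] serves the weak and the strict bound at
    once. *)
Lemma d_cases q (P : R -> Prop) : (1 < size q)%N -> q^`() != 0 ->
  (forall z, root q z -> exists2 w, root q^`() w & forall x, x <= normc (z - w) -> P x) ->
  P (d q).
Proof.
move=> sq q'0 h; have q0 : q != 0 by rewrite -size_poly_eq0; lia.
have zq : zeros q != [::] by rewrite -size_eq0 size_zeros//; lia.
have [] := @seq_maxP R [seq seq_min [seq normc (z - w) | w <- zeros q^`()] | z <- zeros q].
  by move: zq; case: (zeros q).
move=> /mapP[z]; rewrite mem_zeros// => /h[w wq hw] e _.
rewrite /d e; apply: hw.
have := mem_zeros w q'0; rewrite wq => wz.
have [] := @seq_minP R [seq normc (z - w) | w <- zeros q^`()].
  by move: wz; case: (zeros q^`()).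
by move=> _; apply; apply: map_f.
Qed.

Lemma d_le q r : (1 < size q)%N -> q^`() != 0 ->
  (forall z, root q z -> exists2 w, root q^`() w & normc (z - w) <= r) ->
  d q <= r.
Proof.
move=> sq q'0 h; apply: (d_cases (P := fun x => x <= r)) => // z /h[w ? ?].
exists w => // x hx; exact: le_trans hx _.
Qed.

Lemma d_lt q r : (1 < size q)%N -> q^`() != 0 ->
  (forall z, root q z -> exists2 w, root q^`() w & normc (z - w) < r) ->
  d q < r.
Proof.
move=> sq q'0 h; apply: (d_cases (P := fun x => x < r)) => // z /h[w ? ?].
exists w => // x hx; exact: le_lt_trans hx _.
Qed.

Lemma lead_deriv n q : size q = n.+1 -> q \is monic ->
  (0 < n)%N -> lead_coef q^`() = n%:R /\ size q^`() = n.
Proof.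
move=> sq mq n0; have s : size q^`() = n.
  apply/eqP; rewrite eqn_leq; apply/andP; split.
    by have := lt_size_deriv (monic_neq0 mq); rewrite sq ltnS.
  rewrite -{1}(prednK n0) ltnNge; apply/negP => /leq_sizeP/(_ _ (leqnn _)).
  rewrite coef_deriv prednK//.
  have := mq; rewrite monicE lead_coefE sq /= => /eqP -> /eqP.
  by rewrite pnatr_eq0; lia.
split=> //; rewrite lead_coefE s coef_deriv prednK//.
by have := mq; rewrite monicE lead_coefE sq /= => /eqP ->.
Qed.

Lemma deriv_zeros n q : size q = n.+1 -> q \is monic -> (0 < n)%N ->
  [/\ q^`() != 0, q^`() = n%:R *: \prod_(w <- zeros q^`()) ('X - w%:P),
      size (zeros q^`()) = n.-1 & zeros q^`() =i root q^`()].
Proof.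
move=> sq mq n0; have [l s] := lead_deriv sq mq n0.
have q'0 : q^`() != 0 by rewrite -size_poly_eq0 s; lia.
split=> //; first by rewrite -l -zeros_spec.
  by rewrite size_zeros// s.
by move=> w; rewrite mem_zeros.
Qed.

(** At 0 this ties the critical points to the zeros; at a critical point of a nearby polynomial it
    measures how close the critical points of [q] come. *)
Lemma normc_deriv n q x : size q = n.+1 -> q \is monic -> (0 < n)%N ->
  normc q^`().[x] = n%:R * \prod_(w <- zeros q^`()) normc (x - w).
Proof.
move=> sq mq n0; have [_ e _ _] := deriv_zeros sq mq n0.
rewrite {1}e hornerZ normcM normc_nat horner_prod normc_prod; congr (_ * _).
by apply: eq_bigr => w _; rewrite hornerXsubC.
Qed.

(** Only one factor ['X] is split off, so [s] still contains 0 when 0 is a multiple zero. *)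
Lemma inS0_factor n q : inS0 n q -> exists s : seq R[i],
  [/\ size s = n.-1, q = 'X * \prod_(z <- s) ('X - z%:P),
      forall z, z \in s -> normc z <= 1 & forall z, root q z = (z == 0) || (z \in s)].
Proof.
case=> mq sq h r0; have q0 := monic_neq0 mq.
have := mem_zeros 0 q0; rewrite r0 => /perm_to_rem pz.
have zq := zeros_spec q; rewrite (monicP mq) scale1r in zq.
exists (rem 0 (zeros q)); split.
- by have := perm_size pz; rewrite size_zeros// sq /= => ->.
- by rewrite {1}zq (perm_big _ pz) /= big_cons subr0.
- by move=> z /mem_rem; rewrite mem_zeros//; exact: h.
- by move=> z; rewrite -mem_zeros// (perm_mem pz) inE.
Qed.

Lemma deriv_at0 (g : {poly R[i]}) : ('X * g)^`().[0] = g.[0].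
Proof. by rewrite derivM derivX hornerD !hornerM hornerX hornerC mul1r mul0r addr0. Qed.

Lemma inS0_crit_le n q : (2 <= n)%N -> inS0 n q ->
  exists2 w, root q^`() w & normc w <= crit_radius n.
Proof.
move=> hn hq; have [mq sq _ _] := hq; have n0 : (0 < n)%N by lia.
have [s [ss e hs _]] := inS0_factor hq.
have := normc_deriv 0 sq mq n0.
have [q'0 _ szq mzq] := deriv_zeros sq mq n0.
have [|b1 _] := @prod_le1_eq1 R _ s (@normc R).
  by move=> z /hs; rewrite normc_ge0.
rewrite {1}e deriv_at0 horner_prod normc_prod.
rewrite (eq_bigr (@normc R)); last first.
  by move=> z _; rewrite hornerXsubC sub0r normc_opp.
move=> E.
apply: contrapT => hno.
have hw w : w \in zeros q^`() -> crit_radius n < normc w.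
  by rewrite mzq => rw; rewrite ltNge; apply/negP => hle; apply: hno; exists w.
have : \prod_(w <- zeros q^`()) normc (0 - w) <= n%:R^-1.
  by rewrite -(@ler_pM2l _ n%:R) ?ltr0n// -E mulfV ?pnatr_eq0//; lia.
rewrite -crit_radiusX// -szq => hle.
have F := prod_eq_exp (crit_radius_gt0 R hn) _ hle.
(* By [F] all factors equal the radius, against the strict bound [hw]; since [n >= 2] there is a
   factor to contradict. *)
have [w wz] : exists w, w \in zeros q^`().
  move: szq; case: (zeros q^`()) => [/= |w t _]; first by lia.
  by exists w; rewrite mem_head.
have := hw w wz; have -> : normc w = crit_radius n; last by rewrite ltxx.
rewrite -(F _ w)// ?sub0r ?normc_opp// => i /hw /ltW.
by rewrite sub0r normc_opp.
Qed.

(** Write r for the critical radius. The moduli of the critical points have product at least r^(n-1)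
    = 1/n, and n times this product is the product of the moduli of [s], at most 1. Both bounds are
    thus attained, hence attained factor by factor. *)
Lemma inS0_extremal n q : (2 <= n)%N -> inS0 n q ->
  (forall w, root q^`() w -> crit_radius n <= normc w) ->
  (forall z, root q z -> z != 0 -> normc z = 1) /\
  (forall w, root q^`() w -> normc w = crit_radius n).
Proof.
move=> hn hq hw; have [mq sq _ _] := hq; have n0 : (0 < n)%N by lia.
have [s [ss e hs rt]] := inS0_factor hq.
have := normc_deriv 0 sq mq n0.
have [q'0 _ szq mzq] := deriv_zeros sq mq n0.
have [|b1 b2] := @prod_le1_eq1 R _ s (@normc R).
  by move=> z /hs; rewrite normc_ge0.
rewrite {1}e deriv_at0 horner_prod normc_prod.
rewrite (eq_bigr (@normc R)); last first.
  by move=> z _; rewrite hornerXsubC sub0r normc_opp.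
have -> : \prod_(w <- zeros q^`()) normc (0 - w) = \prod_(w <- zeros q^`()) normc w.
  by apply: eq_bigr => w _; rewrite sub0r normc_opp.
move=> E.
have hz w : w \in zeros q^`() -> crit_radius n <= normc w by rewrite mzq; exact: hw.
have hle : \prod_(w <- zeros q^`()) normc w <= crit_radius n ^+ size (zeros q^`()).
  rewrite szq crit_radiusX//.
  by rewrite -(@ler_pM2l _ n%:R) ?ltr0n// -E mulfV ?pnatr_eq0//; lia.
have hge := prod_ge_exp (ltW (crit_radius_gt0 R hn)) hz.
rewrite szq crit_radiusX// in hge.
split; last first.
  by move=> w; rewrite -[root _ _]mzq; exact: (prod_eq_exp (crit_radius_gt0 R hn) hz hle).
move=> z; rewrite rt => /orP[->//|zs] _; apply: b2 => //.
by rewrite E -[leLHS](@mulfV _ n%:R) ?ler_pM2l ?ltr0n ?pnatr_eq0//; lia.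
Qed.

End DirectedDistance.

(** * The extremal case at 0 *)

Lemma coef_XsubCM (R : nzRingType) (z : R) (P : {poly R}) i :
  (('X - z%:P) * P)`_i = (if i == 0%N then 0 else P`_i.-1) - z * P`_i.
Proof. by rewrite mulrBl coefB coefXM coefCM. Qed.

Lemma self_inversive (R : realType) (s : seq R[i]) (rho : R) :
  (forall z, z \in s -> normc z = rho) ->
  forall i j, (i + j)%N = size s ->
  let P := \prod_(z <- s) ('X - z%:P) in
  (P`_i : R[i])^* * ((rho ^+ 2)%:C%C) ^+ i = (P`_0 : R[i])^* * P`_j.
Proof.
move=> + i j /=.
elim: s i j => [|z s IH] i j hs ij.
  have [-> ->] : i = 0%N /\ j = 0%N by move: ij => /=; lia.
  by rewrite big_nil coef1 /= expr0 mulrC conjC1.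
rewrite big_cons !coef_XsubCM /=.
have hs' x : x \in s -> normc x = rho by move=> xs; apply: hs; rewrite inE xs orbT.
have {}IH k l := IH k l hs'.
have hz : z * z^* = (rho ^+ 2)%:C%C by rewrite mulc_conj hs ?mem_head.
set P := \prod_(z <- s) ('X - z%:P) in IH *.
have PN : P`_(size s) = 1.
  have := monic_prod_XsubC s xpredT id; rewrite monicE lead_coefE size_prod_XsubC.
  by move=> /eqP.
have PS : P`_(size s).+1 = 0 by rewrite nth_default// size_prod_XsubC.
case: i j ij => [|i] [|j] //= ij.
- have -> : j = size s by lia.
  by rewrite PN PS expr0 !mulr1 mulr0 subr0 mulr1.
- have ei : i = size s by lia.
  have := IH (size s) 0%N (addn0 _); rewrite ei PN PS -hz.
  rewrite mulr0 subr0 sub0r rmorph1 !mul1r [_ ^+ _.+1]exprS => ->.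
  by rewrite rmorphN rmorphM; ring.
(* A coefficient of the larger product mixes two consecutive coefficients of [P], so two instances
   of the induction hypothesis are combined. *)
- have := IH i j.+1 ltac:(lia); have := IH i.+1 j ltac:(lia).
  rewrite -hz [_ ^+ i.+1]exprS sub0r rmorphN rmorphM rmorphB rmorphM => e1 e2.
  have aux (a b c zc p p' w : R[i]) : b * (z * zc * w) = c * p -> a * w = c * p' ->
      (a - zc * b) * (z * zc * w) = - (zc * c) * (p - z * p').
    move=> h1 h2; transitivity (a * w * (z * zc) - zc * (b * (z * zc * w))).
      by ring.
    by rewrite h1 h2; ring.
  exact: aux e1 e2.
Qed.

(* The sequence [I j = (n - j) / (j + 1)], [0 <= j < n], is symmetric
   ([I (n - 1 - j) = 1 / I j]) and its successive quotients
   [1 + (n + 1) / ((j + 1) (n - j - 1))] decrease up to the middle.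
   The quotient [X] of index [k] thus separates the outer quotients from the
   inner ones. *)
Lemma middle_coef_ineq (R : realFieldType) (n k : nat) :
  (0 < k)%N -> (2 * k < n.-1)%N ->
  ((n - k)%:R : R) ^+ n.-1 < n%:R ^+ (n.-1 - 2 * k) * (k.+1)%:R ^+ n.-1.
Proof.
move=> k0 kn.
pose I (j : nat) : R := (n%:R - j%:R) / j.+1%:R.
pose A : R := (k%:R + 1) * (n%:R - k%:R - 1).
pose X : R := ((n%:R - k%:R) * (k%:R + 2)) / A.
have kn' : (2 * k%:R + 2 <= n%:R :> R).
  by rewrite -natrM -natrD ler_nat; lia.
have kR0 : (1 : R) <= k%:R by rewrite ler1n.
have A0 : 0 < A by apply: mulr_gt0; lra.
have X0 : 0 < X by apply: divr_gt0 => //; apply: mulr_gt0; lra.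
have I0 j : (j < n)%N -> 0 < I j.
  move=> jn; apply: divr_gt0; last by rewrite ltr0n.
  by rewrite subr_gt0 ltr_nat.
(* [X] is the quotient I k / I (k + 1), so comparing I j / I (j + 1) with it reverses the comparison
   of (j + 1) (n - j - 1) with [A]. *)
have stepE j : (j.+1 < n)%N ->
    (I j < X * I j.+1) = ((k%:R + 1) * (n%:R - k%:R - 1) < (j%:R + 1) * (n%:R - j%:R - 1) :> R)
 /\ (X * I j.+1 < I j) = ((j%:R + 1) * (n%:R - j%:R - 1) < (k%:R + 1) * (n%:R - k%:R - 1) :> R).
  move=> jn; have j0 : (0 : R) <= j%:R by rewrite ler0n.
  have jn' : (j%:R + 2 <= n%:R :> R) by rewrite -natrD ler_nat; lia.
  rewrite /I /X -[j.+2]addn2 -[j.+1]addn1 !natrD.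
  have -> : (n%:R - k%:R) * (k%:R + 2) / A * ((n%:R - (j%:R + 1)) / (j%:R + 2)) =
    ((n%:R - k%:R) * (k%:R + 2) * (n%:R - j%:R - 1)) / (A * (j%:R + 2)) :> R.
    by field; rewrite ?lt0r_neq0//; lra.
  have p1 : (0 : R) < j%:R + 1 by lra.
  have p2 : 0 < A * (j%:R + 2) by apply: mulr_gt0 => //; lra.
  split; rewrite ltr_pdivrMr// [_ / _ * _]mulrAC ltr_pdivlMr//; apply/idP/idP; rewrite /A; nra.
(* From I 0 = n down to I k, every quotient exceeds [X]. *)
have outer j : (j <= k)%N -> X ^+ j * I j <= n%:R /\ ((0 < j)%N -> X ^+ j * I j < n%:R).
  elim: j => [_|j IH jk].
    by rewrite /I expr0 mul1r subr0 divr1; split.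
  have [IH1 _] := IH (ltnW jk).
  have lt : X ^+ j.+1 * I j.+1 < n%:R.
    apply: lt_le_trans IH1; rewrite exprSr -mulrA ltr_pM2l ?exprn_gt0//.
    have [_ ->] := stepE j ltac:(lia).
    have jk' : (j%:R + 1 <= k%:R :> R) by rewrite natr1 ler_nat.
    by nra.
  by split; first exact: ltW.
(* Between k and its mirror index n - 1 - k, every quotient is at most [X]. *)
have inner i : (k + i <= n.-1 - k)%N -> I k <= X ^+ i * I (k + i)%N.
  elim: i => [_|i IH ik]; first by rewrite addn0 expr0 mul1r.
  apply: (le_trans (IH ltac:(lia))); rewrite addnS exprSr -mulrA ler_pM2l ?exprn_gt0//.
  rewrite leNgt; have [_ ->] := stepE (k + i)%N ltac:(lia).
  rewrite -leNgt natrD.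
  have ik' : (2 * k%:R + i%:R + 2 <= n%:R :> R).
    by rewrite -natrM -!natrD ler_nat; lia.
  have i0 : (0 : R) <= i%:R by rewrite ler0n.
  by nra.
have [_ /(_ k0) out] := outer k (leqnn _).
set a := (n.-1 - 2 * k)%N.
have Ik0 : 0 < I k by apply: I0; lia.
(* At the mirror index, [I] takes the value 1 / I k. *)
have inn : I k ^+ 2 <= X ^+ a.
  have := inner a ltac:(lia).
  have -> : I (k + a)%N = (I k)^-1.
    have -> : (k + a)%N = (n - k).-1 by lia.
    rewrite /I prednK; last by lia.
    have -> : ((n - k).-1%:R : R) = n%:R - k%:R - 1.
      have {2}-> : n = ((n - k).-1 + k + 1)%N by lia.
      by rewrite !natrD; ring.
    rewrite natrB; last by lia.
    by rewrite invf_div -natr1; congr (_ / _); ring.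
  by rewrite -ler_pdivrMr ?invr_gt0// invrK expr2.
(* Since n - 1 = 2k + a, the power splits as (I k ^ 2)^k (I k)^a <= (X^k I k)^a < n^a. *)
have IN : I k ^+ n.-1 < n%:R ^+ a.
  have -> : n.-1 = (2 * k + a)%N by lia.
  rewrite exprD exprM.
  apply: (@le_lt_trans _ _ ((X ^+ k * I k) ^+ a)).
    rewrite [(X ^+ k * _) ^+ _]exprMn ler_pM2r ?exprn_gt0// -[X ^+ k ^+ a]exprM mulnC exprM.
    by rewrite lerXn2r// nnegrE ?exprn_ge0// ?sqr_ge0//; exact: ltW.
  rewrite ltrXn2r//; first by rewrite -lt0n; lia.
  by rewrite mulr_ge0// ?exprn_ge0//; exact: ltW.
have -> : ((n - k)%:R : R) = I k * k.+1%:R.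
  by rewrite /I divfK ?pnatr_eq0// natrB//; lia.
by rewrite exprMn ltr_pM2r// exprn_gt0// ltr0n.
Qed.

Lemma rootc_exists (R : realType) m (y : R[i]) :
  (0 < m)%N -> exists w, w ^+ m = y.
Proof.
case: m => // m _.
have [w e] := solve_monicpoly (fun i => if i == 0%N then y else 0) (ltn0Sn m).
exists w; apply: (etrans e).
by rewrite big_ord_recl /= expr0 mulr1 big1 ?addr0// => i _; rewrite mul0r.
Qed.

Lemma normc_self_inversive (R : realType) (s : seq R[i]) (rho : R) :
  (forall z, z \in s -> normc z = rho) ->
  forall i j, (i + j)%N = size s ->
  let P := \prod_(z <- s) ('X - z%:P) in
  normc P`_i * (rho ^+ 2) ^+ i = normc P`_0 * normc P`_j.
Proof.
move=> hs i j ij P; have := congr1 (@normc R) (self_inversive hs ij).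
rewrite !normcM normcX normc_real !normc_conj (ger0_norm (sqr_ge0 rho)).
exact.
Qed.

Section Extremal.
Variables (R : realType) (n : nat) (q : {poly R[i]}).
Hypotheses (hn : (2 <= n)%N) (hq : inS0 n q).
Hypothesis unit_zeros : forall z, root q z -> z != 0 -> normc z = 1.
Hypothesis unit_crit : forall w, root q^`() w -> normc w = crit_radius n.

(** Here [g] = q/z is self-inversive for the unit circle and q'/n for the circle of the critical
    radius. Their coefficients differ only by the factors (i + 1)/n, and the two symmetries are
    compatible only where [g] vanishes, at the ends or in the middle. *)
Lemma extremal_coef : exists g : {poly R[i]},
  [/\ q = 'X * g, size g = n, g`_n.-1 = 1, normc g`_0 = 1 &
    (forall i j, (i + j)%N = n.-1 -> (g`_i)^* = (g`_0)^* * g`_j) /\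
    (forall i, (0 < i)%N -> (i < n.-1)%N -> (2 * i)%N != n.-1 -> g`_i = 0)].
Proof using hn hq unit_zeros unit_crit.
have [mq sq _ _] := hq; have n0 : (0 < n)%N by lia.
have [s [ss e _ rt]] := inS0_factor hq.
have [q'0 eq' szq mzq] := deriv_zeros sq mq n0.
(* The critical radius is positive, so 0 is not a critical point; hence 0 is a simple zero and [s]
   avoids it. *)
have hs z : z \in s -> normc z = 1.
  move=> zs; apply: unit_zeros; first by rewrite rt zs orbT.
  apply/eqP => z0; have := crit_radius_gt0 R hn; rewrite -(unit_crit (w := 0)).
    by rewrite normc0 ltxx.
  rewrite rootE e deriv_at0 -rootE root_prod_XsubC.
  by rewrite -z0.
have hw w : w \in zeros q^`() -> normc w = crit_radius n.
  by rewrite mzq; exact: unit_crit.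
set g := \prod_(z <- s) ('X - z%:P) in e *.
have sg : size g = n by rewrite size_prod_XsubC ss; lia.
have gN : g`_n.-1 = 1.
  have := monic_prod_XsubC s xpredT id; rewrite monicE lead_coefE -/g sg.
  by move=> /eqP.
have G i j : (i + j)%N = n.-1 -> normc g`_i = normc g`_0 * normc g`_j.
  rewrite -ss => ij; rewrite -(normc_self_inversive hs ij) -[LHS]mulr1.
  by congr (_ * _); rewrite !expr1n.
have g0 : normc g`_0 = 1.
  have := G _ _ (addn0 _); rewrite gN normc1 -expr2 => /esym/eqP.
  by rewrite pexpr_eq1 ?normc_ge0// => /eqP.
have nR0 : (0 : R) < n%:R by rewrite ltr0n.
pose h := \prod_(w <- zeros q^`()) ('X - w%:P).
have hE i : n%:R * normc h`_i = i.+1%:R * normc g`_i.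
  have E : (n%:R * h`_i : R[i]) = i.+1%:R * g`_i.
    have qg : q`_i.+1 = g`_i by rewrite e coefXM.
    by have := coef_deriv q i; rewrite {1}eq' coefZ qg => ->; rewrite mulr_natl.
  by have := congr1 (@normc R) E; rewrite !normcM !normc_nat.
(* The symmetry of the monic multiple [h] of q' rewritten for [g], with |h_0| = 1/n. *)
have H i j : (i + j)%N = n.-1 ->
    n%:R * i.+1%:R * normc g`_i * (crit_radius n ^+ 2) ^+ i = j.+1%:R * normc g`_j.
  rewrite -szq => ij; have := normc_self_inversive hw ij.
  rewrite -/h => E; rewrite -(mulrA n%:R) -hE -hE.
  have := hE 0%N; rewrite g0 mulr1 => E0.
  by transitivity (n%:R * n%:R * (normc h`_i * (crit_radius n ^+ 2) ^+ i));
    [ring | rewrite E; transitivity (n%:R * (n%:R * normc h`_0) * normc h`_j);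
     [ring | rewrite E0; ring]].
(* If g_i were nonzero, [G] and [H] would give n (i + 1) r^(2i) = n - i. Raising this to the power n
   - 1 eliminates the radius r and contradicts [middle_coef_ineq]. *)
have V i : (0 < i)%N -> (2 * i < n.-1)%N -> g`_i = 0.
  move=> i0 iN; apply: eq0_normc; apply/eqP; apply: contraT => gi.
  pose ri : R := (crit_radius n ^+ 2) ^+ i.
  have rE : ri ^+ n.-1 = n%:R ^- (2 * i).
    by rewrite -!exprM mulnA mulnC exprM crit_radiusX// exprVn.
  have ij : (i + (n.-1 - i))%N = n.-1 by lia.
  have := H _ _ ij; have := G _ _ ij; rewrite g0 mul1r => <-.
  have -> : (n.-1 - i).+1 = (n - i)%N by lia.
  rewrite -/ri mulrAC => /(mulIf gi)/(congr1 (fun x => x ^+ n.-1)).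
  rewrite !exprMn rE.
  have := middle_coef_ineq R i0 iN => /[swap] <-.
  have nN : n%:R ^+ n.-1 = n%:R ^+ (n.-1 - 2 * i) * n%:R ^+ (2 * i) :> R.
    by rewrite -exprD subnK// ltnW.
  by rewrite mulrAC nN mulfK ?ltxx// expf_neq0// lt0r_neq0.
exists g; split=> //; split.
  move=> i j; rewrite -ss => ij; rewrite -(self_inversive hs ij).
  have c1 : (1 : R)%:C%C ^+ i = 1 by exact: expr1n.
  by rewrite expr1n c1; exact/esym/mulr1.
move=> i i0 iN i2; have [?|?] := ltnP (2 * i) n.-1; first exact: V.
(* Above the middle, the modulus equals that of the mirror coefficient. *)
have ij : (i + (n.-1 - i))%N = n.-1 by lia.
apply: eq0_normc; rewrite (G _ _ ij) (V (n.-1 - i)%N) ?normc0 ?mulr0//; lia.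
Qed.

(** Half the argument of g_0 gives theta. In odd degree the symmetry at the middle index makes
    lambda real. For the bound on lambda, the powers w^m of critical points are the roots of a
    quadratic y^2 + b y + c; both have modulus r^m = 1/sqrt n, so their sum gives |b| <= 2/sqrt
    n. *)
Lemma extremal_inM : inM n q.
Proof using hn hq unit_zeros unit_crit.
have [mq sq _ _] := hq; have n0 : (0 < n)%N by lia.
have [g [e sg gN g0 [G V]]] := extremal_coef.
have [t0 _ et0] := expi_surj g0.
pose t := t0 / 2.
have et : g`_0 = expi (2 * t) by rewrite et0 /t; congr expi; field.
have [m [m0 [nm|nm]]] : exists m, (1 <= m)%N /\ (n = (2 * m)%N \/ n = (2 * m + 1)%N).
  exists n./2; split; first lia.
  by have := odd_double_half n; case: (odd n) => <-; [right|left]; lia.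
- left; exists m; split=> //; exists t; rewrite -nm -et.
  apply/polyP => i; rewrite e coefXM coefD coefXn coefZ coefX.
  case: i => [|i] /=; first by rewrite mulr0 addr0; case: (n) n0.
  have [->|i0] := posnP i.
    by rewrite eqxx mulr1 eqn_leq [(n <= 1)%N]leqNgt hn andbF add0r.
  rewrite [i.+1 == 1%N]eqSS (gtn_eqF i0) mulr0 addr0.
  have [ni|/eqP ni] := eqVneq i.+1 n.
    by rewrite (_ : i = n.-1) ?gN//; lia.
  have [?|?] := ltnP i n; last by rewrite nth_default ?sg.
  by rewrite V//; lia.
- right; exists m; split=> //.
  have Gm : (g`_m)^* = (g`_0)^* * g`_m by apply: G; lia.
  pose u := expi t; have nu : normc u = 1 by exact: normc_expi.
  have uu : u * u^* = 1 by rewrite mulc_conj nu expr1n rmorph1.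
  have g0u : g`_0 = u ^+ 2 by rewrite et expi2.
  (* Dividing g_m by the unit [u], a square root of g_0, makes it self-conjugate. *)
  pose lam : R[i] := g`_m * u^*.
  have lamR : complex.Im lam = 0.
    have : lam^* = lam.
      transitivity ((g`_m)^* * u).
        by rewrite /lam rmorphM; congr (_ * _); exact: conjCK.
      have g0c : (u ^+ 2)^* = (u^*) ^+ 2 by exact: rmorphXn.
      by rewrite Gm g0u g0c /lam -[RHS]mulr1 -uu; ring.
    by case: lam => a b [] /= ?; lra.
  have lamE : lam = (complex.Re lam)%:C%C.
    by move: lamR; case: (lam) => a b /= ->.
  have gm : g`_m = (complex.Re lam)%:C%C * u by rewrite -lamE /lam -mulrA [u^* * u]mulrC uu mulr1.
  exists (complex.Re lam), t; split; last first.
    rewrite -nm -et -/u -gm.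
    apply/polyP => i; rewrite e coefXM !coefD coefXn !coefZ coefX coefXn.
    case: i => [|i] /=; first by rewrite addn1 /= !mulr0 !addr0; case: (n) n0.
    have [->|i0] := posnP i.
      rewrite eqxx mulr1 eqn_leq [(n <= 1)%N]leqNgt hn andbF add0r.
      by rewrite addn1 eqSS (ltn_eqF m0) mulr0 add0r.
    rewrite [i.+1 == 1%N]eqSS (gtn_eqF i0) mulr0 addr0 addn1 eqSS.
    have [eim|/eqP im] := eqVneq i m.
      by rewrite eim mulr1 (ltn_eqF (_ : m.+1 < n)%N) ?add0r//; lia.
    rewrite mulr0 addr0.
    have [ni|/eqP ni] := eqVneq i.+1 n.
    by rewrite (_ : i = n.-1) ?gN//; lia.
    have [?|?] := ltnP i n; last by rewrite nth_default ?sg.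
    by rewrite V//; apply/eqP; lia.
  have <- : normc g`_m = `|complex.Re lam| by rewrite gm normcM nu mulr1 normc_real.
  have nC0 : (n%:R : R[i]) != 0 by rewrite pnatr_eq0; lia.
  pose b : R[i] := m.+1%:R / n%:R * g`_m; pose c : R[i] := g`_0 / n%:R.
  have crit w : w ^+ m * w ^+ m + b * w ^+ m + c = 0 -> normc w = crit_radius n.
    move=> hw; apply: unit_crit.
    have -> : q = 'X ^+ n + g`_m *: 'X^(m.+1) + g`_0 *: 'X.
      apply/polyP => i; rewrite e coefXM !coefD coefXn !coefZ coefX coefXn.
      case: i => [|i] /=; first by rewrite !mulr0 !addr0; case: (n) n0.
      have [->|i0] := posnP i.
        rewrite eqxx mulr1 eqn_leq [(n <= 1)%N]leqNgt hn andbF add0r.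
        by rewrite eqSS (ltn_eqF m0) mulr0 add0r.
      rewrite [i.+1 == 1%N]eqSS (gtn_eqF i0) mulr0 addr0 eqSS.
      have [eim|/eqP im] := eqVneq i m.
        by rewrite eim mulr1 (ltn_eqF (_ : m.+1 < n)%N) ?add0r//; lia.
      rewrite mulr0 addr0.
      have [ni|/eqP ni] := eqVneq i.+1 n.
    by rewrite (_ : i = n.-1) ?gN//; lia.
      have [?|?] := ltnP i n; last by rewrite nth_default ?sg.
      by rewrite V//; apply/eqP; lia.
    rewrite rootE !derivD !derivZ !derivXn derivX.
    rewrite !(hornerD,hornerZ,hornerMn,hornerXn,hornerC).
    apply/eqP; transitivity (n%:R * (w ^+ m * w ^+ m + b * w ^+ m + c)).
      have -> : n.-1 = (m + m)%N by lia.
      rewrite exprD -[(w ^+ m * w ^+ m) *+ n]mulr_natl -[w ^+ m *+ m.+1]mulr_natl.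
      by rewrite /b /c; field.
    by rewrite hw mulr0.
  have [y1 hy1] : exists y, y ^+ 2 + b * y + c = 0.
    have [w hw] := rootc_exists (b ^+ 2 / 4 - c) (ltn0Sn 1).
    by exists (w - b / 2); transitivity (w ^+ 2 - (b ^+ 2 / 4 - c)); [field | rewrite hw subrr].
  have hy2 : (- b - y1) ^+ 2 + b * (- b - y1) + c = 0 by rewrite -hy1; ring.
  have Y y : y ^+ 2 + b * y + c = 0 -> normc y = crit_radius n ^+ m.
    have [w <-] := rootc_exists y m0.
    by rewrite expr2 => /crit hw; rewrite normcX hw.
  have rm : crit_radius n ^+ m = (Num.sqrt n%:R)^-1 :> R.
    apply: (@pexpIrn _ 2); rewrite ?nnegrE ?exprn_ge0 ?invr_ge0 ?sqrtr_ge0 ?ltW ?crit_radius_gt0//.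
    rewrite exprVn sqr_sqrtr ?ler0n// -exprM -crit_radiusX//; congr (_ ^+ _); lia.
  have : normc b <= 2 / Num.sqrt n%:R.
    have -> : b = - (y1 + (- b - y1)) by ring.
    rewrite normc_opp; apply: le_trans (normcD_le _ _) _.
    by rewrite (Y _ hy1) (Y _ hy2) rm mulr_natl mulr2n.
  rewrite /b !normcM normcV !normc_nat -nm addn1.
  have s0 : 0 < Num.sqrt n%:R :> R by rewrite sqrtr_gt0 ltr0n.
  have nE : n%:R = Num.sqrt n%:R ^+ 2 :> R by rewrite sqr_sqrtr// ler0n.
  have m10 : (0 : R) < m.+1%:R by rewrite ltr0n.
  rewrite ler_pdivlMr// ler_pdivlMr//.
  set S := Num.sqrt _ in s0 nE *; rewrite {1}nE => hle.
  have -> : normc g`_m * m.+1%:R = m.+1%:R / S ^+ 2 * normc g`_m * S * S.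
    by field; rewrite lt0r_neq0.
  by rewrite ler_pM2r.
Qed.

End Extremal.

(** * Degrees 2 and 3 *)

Lemma parallelogram (R : realType) (x y : R[i]) :
  normc (x + y) ^+ 2 + normc (x - y) ^+ 2 = 2 * (normc x ^+ 2 + normc y ^+ 2).
Proof. by rewrite !sqr_normc_ReIm; case: x y => [a b] [c d] /=; ring. Qed.

(* The relation is a Moebius involution exchanging the inside and the outside
   of the circle of radius 1 / sqrt 3. *)
Lemma cubic_involution (R : realType) (u v : R[i]) :
  3 * (u + v) = 2 + 6 * (u * v) -> 3^-1 <= normc u ^+ 2 -> normc v ^+ 2 <= 3^-1.
Proof.
move=> uv hu.
have E : u * (3 - 6 * v) = 2 - 3 * v.
  apply/eqP; rewrite -subr_eq0.
  have -> : u * (3 - 6 * v) - (2 - 3 * v) = 3 * (u + v) - (2 + 6 * (u * v)) by ring.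
  by rewrite uv subrr.
have := congr1 (fun x => normc x ^+ 2) E; rewrite /= normcM exprMn.
have -> : normc (3 - 6 * v) ^+ 2 = 9 - 36 * complex.Re v + 36 * normc v ^+ 2.
  by rewrite !sqr_normc_ReIm; case: v {uv E} => c d /=; ring.
have -> : normc (2 - 3 * v) ^+ 2 = 4 - 12 * complex.Re v + 9 * normc v ^+ 2.
  by rewrite !sqr_normc_ReIm; case: v {uv E} => c d /=; ring.
have : 0 <= 9 - 36 * complex.Re v + 36 * normc v ^+ 2.
  rewrite sqr_normc_ReIm; case: v {uv E} => c d /=.
  have := sqr_ge0 (6 * c - 3); have := sqr_ge0 d; lra.
by move: (normc u ^+ 2) (normc v ^+ 2) (complex.Re v) hu => U V c; nra.
Qed.

(** No perturbation enters. If neither critical point is strictly within the radius of [a], the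
    involution forces |u| = |v| = 1/sqrt 3 and |a| = 1. The constraint |b| <= 1 on the remaining
    zero then forces u = v and |b| = 1, the extremal case. *)
Lemma cubic_crit (R : realType) (q : {poly R[i]}) (a : R[i]) :
  inS0 3 q -> root q a -> a != 0 ->
  (exists2 w, root q^`() w & normc (a - w) < crit_radius 3) \/
  (inM 3 q /\ exists2 w, root q^`() w & normc (a - w) <= crit_radius 3).
Proof.
move=> hq ra a0; have [mq sq hle _] := hq.
have [|hno] := pselect (exists2 w, root q^`() w & normc (a - w) < crit_radius 3).
  by left.
right.
have r2 : crit_radius 3 ^+ 2 = 3^-1 :> R by apply: crit_radiusX.
have r0 : 0 < crit_radius 3 :> R by apply: crit_radius_gt0.
set r : R := crit_radius 3 in r2 r0 hno *.
have [s [ss e hs rt]] := inS0_factor hq.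
have [b sE] : exists b, perm_eq s [:: a; b].
  have : a \in s by move: ra; rewrite rt (negbTE a0).
  move=> /perm_to_rem p; have := perm_size p; rewrite ss /=.
  by case: (rem a s) p => [|b []] // p _; exists b.
have {}e : q = 'X * (('X - a%:P) * ('X - b%:P)).
  by rewrite e (perm_big _ sE) big_cons big_seq1.
have [q'0 e' szq mzq] := deriv_zeros sq mq (ltn0Sn 2).
case: (zeros q^`()) e' szq mzq => [|w1 [|w2 []]] //= e' _ mzq.
have P x : 3 * ((x - w1) * (x - w2)) = (x - a) * (x - b) + x * (x - b) + x * (x - a).
  have := congr1 (fun p : {poly R[i]} => p.[x]) e'.
  rewrite /= !big_cons big_nil mulr1 e !derivM derivX !derivXsubC.
  by rewrite !hornerE => <- /=; ring.
have rw w : root q^`() w -> w = w1 \/ w = w2.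
  by rewrite -[root _ _]mzq !inE => /orP[] /eqP; [left|right].
have R1 : root q^`() w1 by rewrite -[root _ _]mzq mem_head.
have R2 : root q^`() w2 by rewrite -[root _ _]mzq !inE eqxx orbT.
have far w : root q^`() w -> r <= normc (a - w).
  by move=> h; rewrite leNgt; apply/negP => lt; apply: hno; exists w.
have E0 : w1 * w2 = a * b / 3.
  (* Vieta's formulas for q' come from evaluating [P] at 0 and at 1. *)
  have := P 0 => h; apply: (mulfI (_ : 3%:R != 0)); first by rewrite pnatr_eq0.
  transitivity (3 * ((0 - w1) * (0 - w2))); first by ring.
  by rewrite h; field.
have E1 : w1 + w2 = 2 * (a + b) / 3.
  have := P 1 => h; apply: (mulfI (_ : 3%:R != 0)); first by rewrite pnatr_eq0.
  transitivity (3 + 3 * (w1 * w2) - 3 * ((1 - w1) * (1 - w2))); first by ring.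
  by rewrite h E0; field.
pose u := (a - w1) / a; pose v := (a - w2) / a.
have Euv : u * v = (1 - b / a) / 3.
  transitivity ((a ^+ 2 - a * (w1 + w2) + w1 * w2) / a ^+ 2); first by rewrite /u /v; field.
  by rewrite E0 E1; field.
have Esum : u + v = 2 - (w1 + w2) / a by rewrite /u /v; field.
have uv : 3 * (u + v) = 2 + 6 * (u * v) by rewrite Esum Euv E1; field.
have vu : 3 * (v + u) = 2 + 6 * (v * u) by rewrite addrC uv [u * v]mulrC.
have na0 : 0 < normc a by rewrite normc_gt0.
have na1 := hle _ ra.
(* This uses |a| <= 1. *)
have big w : root q^`() w -> 3^-1 <= normc ((a - w) / a) ^+ 2.
  move=> /far h; rewrite normcM normcV -r2 lerXn2r// ?nnegrE ?divr_ge0 ?normc_ge0//; first exact: ltW.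
  by rewrite ler_pdivlMr//; nra.
have U : normc u ^+ 2 = 3^-1.
  by apply/le_anti; rewrite (cubic_involution vu (big _ R2)) big.
have V : normc v ^+ 2 = 3^-1.
  by apply/le_anti; rewrite (cubic_involution uv (big _ R1)) big.
have nu : normc u = r.
  by apply: (@pexpIrn _ 2); rewrite ?nnegrE ?normc_ge0 ?U ?r2// ltW.
have na : normc a = 1.
  have := far _ R1; have -> : normc (a - w1) = r * normc a.
    by rewrite -nu -normcM; congr normc; rewrite /u; field.
  by nra.
have close : normc (a - w1) <= r.
  have -> : a - w1 = u * a by rewrite /u; field.
  by rewrite normcM nu na mulr1.
split; last by exists w1.
pose c := 3 * (u * v).
have nc : normc c ^+ 2 = 1.
  rewrite /c normcM normc_nat (normcM u v).
  transitivity (9 * normc u ^+ 2 * normc v ^+ 2); first by ring.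
  by rewrite U V; field.
have cE : b = a * (1 - c) by rewrite /c Euv; field.
have nb : normc b = normc (1 - c) by rewrite cE normcM na mul1r.
have rb : root q b by rewrite rt (perm_mem sE) !inE eqxx !orbT.
have nb1 := hle _ rb; rewrite nb in nb1.
(* As 1 + c = 3/2 (u + v), the identities for (1, c) and (u, v) give |1 - c|^2 = 1 + 9/4 |u - v|^2,
   while |1 - c| = |b| <= 1. *)
have := parallelogram 1 c; rewrite nc normc1.
have -> : 1 + c = 3 / 2 * (u + v) by rewrite -[3 / 2 * _]mulrAC uv /c; field.
rewrite !normcM normcV !normc_nat => par1.
have := parallelogram u v; rewrite U V => par2.
have ge_uv := sqr_ge0 (normc (u - v)).
have nb0 := normc_ge0 (1 - c).
have nbE : normc (1 - c) = 1 by nra.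
rewrite nbE in par1.
have : normc (u - v) ^+ 2 = 0 by lra.
move=> /eqP; rewrite sqrf_eq0 => /eqP/eq0_normc/subr0_eq euv.
have ew : w1 = w2.
  have -> : w1 = a - u * a by rewrite /u; field.
  by rewrite euv /v; field.
have nw : normc w1 = r.
  apply: (@pexpIrn _ 2); rewrite ?nnegrE ?normc_ge0 ?r2//; first exact: ltW.
  by rewrite expr2 -normcM {2}ew E0 !normcM normcV normc_nat na nb nbE; field.
apply: extremal_inM => //.
- move=> z; rewrite rt (perm_mem sE) !inE => /or3P[->//|/eqP->//|/eqP->] _.
  by rewrite nb.
- by move=> w /rw [->|->//]; rewrite -?ew.
Qed.

Lemma quadratic_crit (R : realType) (q : {poly R[i]}) (a : R[i]) :
  inS0 2 q -> root q a -> a != 0 ->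
  (exists2 w, root q^`() w & normc (a - w) < crit_radius 2) \/
  (inM 2 q /\ exists2 w, root q^`() w & normc (a - w) <= crit_radius 2).
Proof.
move=> hq ra a0; have [mq sq hle _] := hq; have na := hle _ ra.
have r2 : crit_radius 2 = 2^-1 :> R by have := crit_radiusX R (leqnn 2); rewrite expr1.
have [s [ss e hs rt]] := inS0_factor hq.
have {}e : q = 'X * ('X - a%:P).
  have : a \in s by move: ra; rewrite rt (negbTE a0).
  case: s ss e {hs rt} => [|b []] // _ ->; rewrite inE => /eqP <-.
  by rewrite big_cons big_nil mulr1.
have rw : root q^`() (a / 2).
  by rewrite rootE e derivM derivX derivXsubC !hornerE; apply/eqP; field.
have nw : normc (a - a / 2) = normc a / 2.
  have -> : a - a / 2 = a / 2 by field.
  by rewrite normcM normcV normc_nat.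
have [a1|a1] := eqVneq (normc a) 1; last first.
  left; exists (a / 2) => //; rewrite nw r2.
  have : normc a < 1 by rewrite lt_def eq_sym a1.
  by lra.
right; split; last by exists (a / 2) => //; rewrite nw r2 a1; lra.
left; exists 1%N; split=> //.
have : normc (- a) = 1 by rewrite normc_opp.
move=> /expi_surj[t _ et]; exists (t / 2).
have -> : 2 * (t / 2) = t by field.
by rewrite -et e muln1 expr2 mulrBr scaleNr -mul_polyC mulrC [a%:P * _]mulrC.
Qed.

(** * Nonzero zeros of the extremal polynomials *)

Lemma ltn_exp2_pred n : (3 <= n)%N -> (n < 2 ^ n.-1)%N.
Proof.
elim: n => // n IH; rewrite ltnS leq_eqVlt => /predU1P[<-//|n3].
by have := IH n3; case: n {IH} n3 => // n _; rewrite /= !expnS; lia.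
Qed.

Lemma ltn_sqr_exp2_pred n : (7 <= n)%N -> (n ^ 2 < 2 ^ n.-1)%N.
Proof.
elim: n => // n IH; rewrite ltnS leq_eqVlt => /predU1P[<-//|n7].
have := IH n7; case: n {IH} n7 => // n n7; rewrite /= [(2 ^ n.+1)%N]expnS; nia.
Qed.

Lemma crit_radius_gt_half (R : realType) n :
  (3 <= n)%N -> 2^-1 < crit_radius n :> R.
Proof.
move=> n3; rewrite ltNge; apply/negP => h.
have hn : (2 <= n)%N by lia.
have := lerXn2r n.-1 (_ : crit_radius n \is Num.nneg) (_ : (2^-1 : R) \is Num.nneg) h.
rewrite !nnegrE invr_ge0 ler0n (ltW (crit_radius_gt0 R hn)) => /(_ isT isT).
rewrite crit_radiusX// exprVn lef_pV2 ?posrE ?exprn_gt0 ?ltr0n//; last by lia.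
by rewrite -natrX ler_nat leqNgt ltn_exp2_pred.
Qed.

(** In degree 5 the squared radius is 1/sqrt 5 < 1/2; [odd_crit] treats that degree separately. *)
Lemma sqr_crit_radius_gt_half (R : realType) n :
  (7 <= n)%N -> 2^-1 < crit_radius n ^+ 2 :> R.
Proof.
move=> n7; rewrite ltNge; apply/negP => h.
have hn : (2 <= n)%N by lia.
have := lerXn2r n.-1 (_ : crit_radius n ^+ 2 \is Num.nneg) (_ : (2^-1 : R) \is Num.nneg) h.
rewrite !nnegrE invr_ge0 ler0n sqr_ge0 => /(_ isT isT).
rewrite -exprM mulnC exprM crit_radiusX// !exprVn lef_pV2 ?posrE ?exprn_gt0 ?ltr0n//; last by lia.
by rewrite -!natrX ler_nat leqNgt ltn_sqr_exp2_pred.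
Qed.

(* The root whose argument is that of v in [-pi, pi] divided by m: since m >= 2,
   its cosine is at least that of the half argument of v. *)
Lemma rootc_near_real (R : realType) m (v : R[i]) : (2 <= m)%N -> v != 0 ->
  exists t, [/\ t ^+ m = v, 0 <= complex.Re t &
    normc t ^+ 2 * (normc v + complex.Re v) <= 2 * complex.Re t ^+ 2 * normc v].
Proof.
move=> m2 v0; have m0 : (0 < m)%N by lia.
have nv0 : 0 < normc v by rewrite normc_gt0.
have [t0 ht0] := rootc_exists v m0.
have /expi_surj[phi phi_pi vE] : normc (v / (normc v)%:C%C) = 1.
  by rewrite normcM normcV normc_real ger0_norm ?normc_ge0// mulfV ?lt0r_neq0.
have {}vE : v = (normc v)%:C%C * expi phi.
  rewrite -vE mulrC divfK// -normc_gt0 normc_real normr_gt0 lt0r_neq0//.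
have rv : complex.Re v = normc v * cos phi.
  by rewrite {1}vE /=; ring.
pose psi := m%:R^-1 * phi.
have mR : (0 : R) < m%:R by rewrite ltr0n.
have mR2 : (2 : R) <= m%:R by rewrite ler_nat.
exists ((normc t0)%:C%C * expi psi); split.
- rewrite exprMn expiX /psi mulrA mulfV ?lt0r_neq0// mul1r [RHS]vE.
  by congr (_ * _); rewrite -rmorphXn /= -normcX ht0.
all: have -> : complex.Re ((normc t0)%:C%C * expi psi) = normc t0 * cos psi by rewrite /=; ring.
all: have psi_le : `|psi| <= `|phi| / 2.
1,3: rewrite normrM ger0_norm ?invr_ge0 ?ler0n// mulrC ler_wpM2l ?normr_ge0//;
  by rewrite lef_pV2 ?posrE.
all: have pi0 := pi_gt0 R; have phi0 := normr_ge0 phi; have psi0 := normr_ge0 psi.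
all: have c0 : 0 <= cos (`|phi| / 2) by apply: cos_ge0_pihalf; lra.
all: have cle : cos (`|phi| / 2) <= cos psi.
1,3: by rewrite -(cos_norm psi) leNgt ltr_cos ?in_itv/=; lra.
- by rewrite mulr_ge0 ?normc_ge0//; lra.
rewrite normcM normc_expi mulr1 normc_real ger0_norm ?normc_ge0// rv.
(* By the double angle formula, |v| + Re v is 2 |v| cos^2 of the half argument. *)
have chalf : cos phi = cos (`|phi| / 2) ^+ 2 *+ 2 - 1.
  rewrite -cos_mulr2n (_ : `|phi| / 2 *+ 2 = `|phi|) ?cos_norm//.
  by field.
have : normc v * cos (`|phi| / 2) ^+ 2 <= normc v * cos psi ^+ 2.
  by rewrite ler_pM2l// lerXn2r// nnegrE; lra.
rewrite exprMn chalf => h.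
have := ler_wpM2l (sqr_ge0 (normc t0)) h.
by rewrite -mulr_natr; lra.
Qed.

Lemma normc_1sub_lt (R : realType) (t : R[i]) :
  1 < 2 * complex.Re t -> normc (1 - t) < normc t.
Proof.
move=> h; rewrite -(@ltr_pXn2r _ 2) ?nnegrE ?normc_ge0//.
by rewrite !sqr_normc_ReIm; case: t h => a b /= h; nra.
Qed.

Section ExtremalZeros.
Variable R : realType.

(** The critical point is [z] shrunk by the critical radius r, at distance 1 - r < r because r >
    1/2. *)
Lemma even_crit m (u z : R[i]) : (2 <= m)%N -> normc u = 1 -> z != 0 ->
  let p := 'X^(2 * m) + u *: 'X in
  root p z -> exists2 w, root p^`() w & normc (z - w) < crit_radius (2 * m).
Proof.
move=> m2 nu z0 p rz.
set n := (2 * m)%N in p rz *; have hn : (2 <= n)%N by rewrite /n; lia.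
have zN : z ^+ n.-1 = - u.
  have : z * (z ^+ n.-1 + u) = 0.
    move: rz; rewrite rootE /p !(hornerD,hornerZ,hornerXn,hornerX) => /eqP <-.
    by rewrite mulrDr -exprS prednK ?[z * u]mulrC//; lia.
  by move=> /eqP; rewrite mulf_eq0 (negbTE z0) addr_eq0 => /eqP.
have nz : normc z = 1.
  have := congr1 (@normc R) zN; rewrite normcX normc_opp nu => /eqP.
  by rewrite pexpr_eq1 ?normc_ge0////; [move=> /eqP | lia].
exists ((crit_radius n)%:C%C * z).
  rewrite rootE derivD derivXn derivZ derivX !(hornerD,hornerZ,hornerMn,hornerXn,hornerC).
  rewrite exprMn zN -rmorphXn /= crit_radiusX// mulr1.
  rewrite -[_ *+ n]mulr_natl mulrA fmorphV rmorph_nat mulfV ?mul1r ?addNr//.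
  by rewrite pnatr_eq0; lia.
have -> : z - (crit_radius n)%:C%C * z = (1 - crit_radius n)%:C%C * z.
  by rewrite rmorphB rmorph1; ring.
have rg := crit_radius_gt_half R (_ : (3 <= n)%N).
have {}rg : 2^-1 < crit_radius n :> R by apply: rg; rewrite /n; lia.
by rewrite normcM nz mulr1 normc_real ltr_norml; apply/andP; split; lra.
Qed.

(** Zeros and critical points become roots of quadratics through y = z^m / u and x = w^m / u: y^2 +
    lam y + 1 = 0 and n x^2 + (m + 1) lam x + 1 = 0. With t^m = x / y, the point z t is critical and
    |t| is the critical radius, so it suffices to reach Re t > 1/2. *)
Lemma odd_crit m (lam : R) (u z : R[i]) : (2 <= m)%N -> normc u = 1 -> z != 0 ->
  `|lam| <= 2 * Num.sqrt (2 * m + 1)%:R / (m + 1)%:R ->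
  let p := 'X^(2 * m + 1) + (lam%:C%C * u) *: 'X^(m + 1) + u ^+ 2 *: 'X in
  root p z -> exists2 w, root p^`() w & normc (z - w) < crit_radius (2 * m + 1).
Proof.
move=> m2 nu z0 hlam p rz.
set n := (2 * m + 1)%N in hlam p rz *; have hn : (2 <= n)%N by rewrite /n; lia.
have m0 : (0 < m)%N by lia.
have nP : n.-1 = (2 * m)%N by rewrite /n; lia.
have n7 : (3 <= m)%N -> (7 <= n)%N by rewrite /n; lia.
have npos : (0 < n)%N by lia.
have u0 : u != 0 by rewrite -normc_gt0 nu ltr01.
have nE : n%:R = 2 * m%:R + 1 :> R by rewrite /n natrD natrM.
have mR : (2 : R) <= m%:R by rewrite ler_nat.
have l2 : (lam * (m%:R + 1)) ^+ 2 <= 4 * n%:R.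
  have h : `|lam * (m%:R + 1)| <= 2 * Num.sqrt n%:R.
    move: hlam; rewrite natrD ler_pdivlMr; last by lra.
    by rewrite normrM [`|_ + 1|]ger0_norm//; lra.
  rewrite -[leLHS]real_normK ?num_real//.
  have -> : 4 * n%:R = (2 * Num.sqrt n%:R) ^+ 2 :> R.
    by rewrite exprMn sqr_sqrtr ?ler0n//; ring.
  by apply: lerXn2r; rewrite ?nnegrE ?mulr_ge0 ?sqrtr_ge0.
pose y := z ^+ m / u.
have zy : z ^+ m = y * u by rewrite /y divfK.
have hy : y * y + lam%:C%C * y + 1 = 0.
  have : z * u ^+ 2 * (y * y + lam%:C%C * y + 1) = 0.
    move: rz; rewrite rootE /p !(hornerD,hornerZ,hornerXn,hornerX) => /eqP <-.
    by rewrite /n !addn1 !exprS mulnC exprM zy; ring.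
  by move=> /eqP; rewrite !mulf_eq0 (negbTE z0) (negbTE u0) => /eqP.
have [a [b [yE ab la bn]]] : exists a b : R, [/\ y = (a +i* b)%C,
    a ^+ 2 + b ^+ 2 = 1, lam = - 2 * a & b != 0].
  case: (y) hy => a b /eqP; rewrite eq_complex /= => /andP[/eqP h1 /eqP h2].
  (* A real [y] would need |lam| >= 2, while [l2] gives |lam| < 2. *)
  exists a, b; have b0 : b != 0.
    apply/eqP => b0; rewrite b0 in h1.
    have l4 : lam ^+ 2 < 4 by nra.
    by have := sqr_ge0 (2 * a + lam); nra.
  have la : lam = - 2 * a.
    by apply: (mulIf b0); lra.
  split=> //.
  by rewrite la in h1; lra.
have ny : normc y = 1.
  by rewrite yE /= ab sqrtr1.
have nz : normc z = 1.
  have := congr1 (@normc R) zy; rewrite normcX normcM ny nu mulr1 => /eqP.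
  by rewrite pexpr_eq1 ?normc_ge0// => /eqP.
pose A := (m%:R + 1) * a / n%:R; pose S := Num.sqrt (n%:R^-1 - A ^+ 2).
have n0 : (0 : R) < n%:R by rewrite ltr0n.
have A2 : A ^+ 2 <= n%:R^-1.
  rewrite /A exprMn exprVn -[n%:R^-1](_ : n%:R / n%:R ^+ 2 = _).
    by rewrite ler_pM2r ?invr_gt0 ?exprn_gt0//; move: l2; rewrite la; lra.
  by field; rewrite lt0r_neq0.
have S2 : S ^+ 2 = n%:R^-1 - A ^+ 2 by rewrite sqr_sqrtr ?subr_ge0.
have S0 : 0 <= S by exact: sqrtr_ge0.
have sg2 : Num.sg b * Num.sg b = 1 by rewrite -expr2 sqr_sg bn.
(* Of the two conjugate roots [x], the one on the same side of the real axis as [y] is taken, which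
   makes Re (x / y) nonnegative. *)
pose B := Num.sg b * S.
have B2 : B ^+ 2 = n%:R^-1 - A ^+ 2 by rewrite /B expr2 mulrACA sg2 mul1r -expr2.
pose x : R[i] := (A +i* B)%C.
have hx : n%:R * (x * x) + (m.+1%:R * lam%:C%C) * x + 1 = 0.
  have -> : (n%:R : R[i]) = (n%:R : R)%:C%C by rewrite rmorph_nat.
  have -> : (m.+1%:R : R[i]) = (m%:R + 1 : R)%:C%C by rewrite rmorphD rmorph1 rmorph_nat natr1.
  have lA : (m%:R + 1) * lam = - 2 * n%:R * A by rewrite la /A; field; rewrite lt0r_neq0.
  apply/eqP; rewrite eq_complex /=; apply/andP; split; apply/eqP.
    transitivity (n%:R * (A ^+ 2 - B ^+ 2) + (m%:R + 1) * lam * A + 1); first by ring.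
    by rewrite lA B2; field; rewrite lt0r_neq0.
  transitivity (n%:R * (2 * A * B) + (m%:R + 1) * lam * B); first by ring.
  by rewrite lA; ring.
have nx : normc x ^+ 2 = n%:R^-1 by rewrite sqr_normc_ReIm /= B2; ring.
pose v := x * y^*.
have nv : normc v = normc x by rewrite normcM normc_conj ny mulr1.
have nv2 : normc v ^+ 2 = n%:R^-1 by rewrite nv.
have nv0 : 0 < normc v.
  by rewrite lt_def normc_ge0 -sqrf_eq0 nv2 invr_eq0 lt0r_neq0.
have rev : complex.Re v = A * a + `|b| * S.
  by rewrite /v yE /Num.conj /= normrEsg /B; ring.
have rev0 : 0 <= complex.Re v.
  rewrite rev; apply: addr_ge0; last by rewrite mulr_ge0 ?normr_ge0.
  have -> : A * a = (m%:R + 1) / n%:R * a ^+ 2 by rewrite /A; field; rewrite lt0r_neq0.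
  by apply: mulr_ge0; [apply: divr_ge0; lra | exact: sqr_ge0].
have [|t [tv t0 tre]] := @rootc_near_real R m v m2; first by rewrite -normc_gt0.
have nt : normc t = crit_radius n.
  apply: (@pexpIrn _ n.-1); rewrite ?nnegrE ?normc_ge0 ?(ltW (crit_radius_gt0 R hn))//.
    by rewrite nP muln_gt0.
  rewrite crit_radiusX// -nv2 -tv -!normcX -!exprM; congr (normc (_ ^+ _)).
  by rewrite nP mulnC.
have r0 := crit_radius_gt0 R hn.
exists (z * t).
  rewrite rootE !derivD !derivZ !derivXn derivX !(hornerD,hornerZ,hornerMn,hornerXn,hornerC).
  rewrite nP mul2n -addnn.
  rewrite addn1 /= exprD exprMn tv zy.
  have E : y * u * v = u * x.
    rewrite /v; transitivity (u * x * (y * y^*)); first by ring.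
    by rewrite mulc_conj ny expr1n mulr1.
  rewrite E; apply/eqP; transitivity (u ^+ 2 * (n%:R * (x * x) + m.+1%:R * lam%:C%C * x + 1)).
    rewrite -[(u * x * (u * x)) *+ n]mulr_natl -[(u * x) *+ m.+1]mulr_natl; ring.
  by rewrite hx mulr0.
have -> : z - z * t = z * (1 - t) by ring.
rewrite normcM nz mul1r -nt; apply: normc_1sub_lt.
rewrite ltNge; apply/negP => tle.
(* If Re t <= 1/2, the choice of [t] gives r^2 (|v| + Re v) <= |v| / 2, hence r^2 <= 1/2, impossible
   for m >= 3. *)
have tsq : complex.Re t ^+ 2 <= 4^-1 by nra.
have tre2 : normc t ^+ 2 * (normc v + complex.Re v) <= 2^-1 * normc v.
  by apply: le_trans tre _; rewrite ler_pM2r//; lra.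
rewrite nt in tre2.
have [m3|m3] := leqP 3 m.
  have rh := sqr_crit_radius_gt_half R (n7 m3).
  by nra.
have m_eq : m = 2%N by apply/eqP; rewrite eqn_leq -ltnS m3 m2.
have vr : crit_radius n ^+ 2 = normc v by rewrite -nt -normcX -m_eq tv.
rewrite vr in tre2.
have {}tre2 : normc v + complex.Re v <= 2^-1.
  by rewrite mulrC in tre2; move: tre2; rewrite ler_pM2r.
have n5 : n%:R = 5 :> R by rewrite /n m_eq.
have m2' : m%:R = 2 :> R by rewrite m_eq.
(* In degree 5, r^2 = |v| = 1/sqrt 5 > 2/5 leaves Re v < 1/10, whereas the bounds on |b| and S give
   Re v >= 2/15. *)
have vge : 2 / 5 < normc v.
  by rewrite n5 in nv2; nra.
rewrite rev in tre2.
have AE : A = 3 * a / 5 by rewrite /A m2' n5; field.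
rewrite la n5 m2' in l2; rewrite n5 AE in S2; rewrite AE in tre2.
have a2 : a ^+ 2 <= 5 / 9 by lra.
have bge : 2 / 3 <= `|b|.
  have : `|b| ^+ 2 = 1 - a ^+ 2 by rewrite real_normK ?num_real//; lra.
  by have := normr_ge0 b; nra.
have S1 : S <= 1 by nra.
have SS : S ^+ 2 <= S by nra.
have : 2 / 3 * S <= `|b| * S by rewrite ler_wpM2r.
by nra.
Qed.

Lemma inM_crit n (p : {poly R[i]}) z : (4 <= n)%N -> inM n p -> root p z -> z != 0 ->
  exists2 w, root p^`() w & normc (z - w) < crit_radius n.
Proof.
move=> n4 [[m [m1 nm [t e]]]|[m [m1 nm [lam [t [hl e]]]]]] rz z0.
  subst n p; apply: even_crit => //; last exact: normc_expi.
  by lia.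
subst n p; rewrite expi2 in rz *; apply: odd_crit => //; last exact: normc_expi.
by lia.
Qed.

Lemma inM_size_monic n (p : {poly R[i]}) : (2 <= n)%N -> inM n p ->
  size p = n.+1 /\ p \is monic.
Proof.
move=> hn hp.
have [r [-> sr]] : exists r, p = 'X^n + r /\ (size r <= n)%N.
  case: hp => [[m [m1 nm [t e]]]|[m [m1 nm [lam [t [hl e]]]]]].
    exists (expi (2 * t) *: 'X); rewrite nm; split=> //.
    apply: (leq_trans (size_scale_leq _ _)); rewrite size_polyX; lia.
  rewrite e nm -addrA; eexists; split; first by [].
  apply: (leq_trans (size_polyD _ _)); rewrite geq_max.
  apply/andP; split; apply: (leq_trans (size_scale_leq _ _));
    rewrite ?size_polyXn ?size_polyX; lia.
split; first by rewrite size_polyDl size_polyXn.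
by rewrite monicE lead_coefDl ?lead_coefXn ?size_polyXn.
Qed.

(** Simplicity of the zero 0 ensures that, under a small perturbation, nonzero zeros of [q] are
    matched with nonzero zeros of [p]. *)
Lemma inM_simple0 n (p : {poly R[i]}) : (2 <= n)%N -> inM n p ->
  exists2 g : {poly R[i]}, p = 'X * g & g.[0] != 0.
Proof.
move=> hn [[m [m1 nm [t ->]]]|[m [m1 nm [lam [t [hl ->]]]]]].
  exists ('X^((2 * m).-1) + (expi (2 * t))%:P).
    rewrite mulrDr -exprS prednK; last by lia.
    by rewrite -mul_polyC [_ * 'X]mulrC.
  rewrite hornerD hornerXn hornerC expr0n (_ : ((2 * m).-1 == 0)%N = false); last by lia.
  by rewrite add0r expi_neq0.
exists ('X^(2 * m) + (lam%:C%C * expi t) *: 'X^m + (expi (2 * t))%:P).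
  rewrite !addn1 !exprS -!mul_polyC; ring.
rewrite !hornerD hornerZ !hornerXn hornerC !expr0n.
have -> : (2 * m == 0)%N = false by lia.
have -> : (m == 0)%N = false by lia.
by rewrite mulr0 !add0r expi_neq0.
Qed.

End ExtremalZeros.

(** * Perturbation *)

Section Perturbation.
Variable R : realType.
Implicit Types (p q : {poly R[i]}).

Lemma mulc_near (x y : R[i]) (eta : R) : 0 < eta ->
  exists2 delta : R, 0 < delta & forall x' y' : R[i],
    normc (x - x') < delta -> normc (y - y') < delta ->
    normc (x * y - x' * y') < eta.
Proof.
move=> eta0; have x0 := normc_ge0 x; have y0 := normc_ge0 y.
(* The error is at most delta (|y| + |x| + 1) once delta <= 1; the extra 1 in [M] makes the bound
   strict. *)
pose M := normc x + normc y + 2; have M0 : 0 < M by rewrite /M; lra.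
exists (Num.min 1 (eta / M)); first by rewrite lt_min ltr01 divr_gt0.
move=> x' y'; rewrite !lt_min !ltr_pdivlMr// => /andP[x1 hx] /andP[y1 hy].
have -> : x * y - x' * y' = (x - x') * y + x' * (y - y') by ring.
apply: le_lt_trans (normcD_le _ _) _; rewrite !normcM.
have x'le : normc x' <= normc x + 1.
  have := normcD_le x (x' - x); rewrite normc_distC addrC subrK; lra.
have hx0 := normc_ge0 (x - x'); have hy0 := normc_ge0 (y - y').
have hx'0 := normc_ge0 x'.
have h1 : normc x' * normc (y - y') <= (normc x + 1) * normc (y - y').
  by rewrite ler_wpM2r.
have h2 : normc (x - x') * normc y * M <= eta * normc y.
  by rewrite mulrAC ler_wpM2r// ltW.
have h3 : (normc x + 1) * normc (y - y') * M <= eta * (normc x + 1).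
  by rewrite -mulrA mulrC ler_wpM2r ?ltW//; lra.
by rewrite -(ltr_pM2r M0); rewrite /M in h2 h3 *; nra.
Qed.

(** Values and derivatives are treated together because the product rule calls on both in the
    induction. *)
Lemma prod_XsubC_near n (a : 'I_n -> R[i]) (w : R[i]) (eta : R) : 0 < eta ->
  exists2 delta : R, 0 < delta & forall b : 'I_n -> R[i],
    (forall i, normc (a i - b i) < delta) ->
    normc ((\prod_i ('X - (a i)%:P)).[w] - (\prod_i ('X - (b i)%:P)).[w]) < eta /\
    normc ((\prod_i ('X - (a i)%:P))^`().[w] - (\prod_i ('X - (b i)%:P))^`().[w]) < eta.
Proof.
elim: n a eta => [|n IH] a eta eta0.
  by exists 1 => // b _; rewrite !big_ord0 !subrr normc0.
have eta2 : 0 < eta / 2 by rewrite divr_gt0.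
pose P := \prod_(i < n) ('X - (a (lift ord0 i))%:P).
have [d1 d1_0 h1] := mulc_near (w - a ord0) P.[w] eta0.
have [d2 d2_0 h2] := mulc_near (w - a ord0) P^`().[w] eta2.
pose e := Num.min (eta / 2) (Num.min d1 d2).
have e0 : 0 < e by rewrite !lt_min eta2 d1_0 d2_0.
have [d d0 h] := IH (fun i => a (lift ord0 i)) e e0.
exists (Num.min d e); first by rewrite lt_min d0.
move=> b hb; rewrite !big_ord_recl -/P.
set Q := \prod_(i < n) ('X - (b (lift ord0 i))%:P).
have [|hP hP'] := h (fun i => b (lift ord0 i)).
  by move=> i; have := hb (lift ord0 i); rewrite lt_min => /andP[].
rewrite -/P -/Q in hP hP'.
have hw : normc ((w - a ord0) - (w - b ord0)) < e.
  have -> : (w - a ord0) - (w - b ord0) = - (a ord0 - b ord0) by ring.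
  by rewrite normc_opp; have := hb ord0; rewrite lt_min => /andP[].
move: hw hP hP'; rewrite !lt_min.
move=> /and3P[_ hw1 hw2] /and3P[hPe hP1 _] /and3P[_ _ hP2].
rewrite !derivM !derivXsubC !mul1r !hornerD !hornerM !hornerXsubC; split; first exact: h1.
have -> : P.[w] + (w - a ord0) * P^`().[w] - (Q.[w] + (w - b ord0) * Q^`().[w]) =
  (P.[w] - Q.[w]) + ((w - a ord0) * P^`().[w] - (w - b ord0) * Q^`().[w]) by ring.
apply: le_lt_trans (normcD_le _ _) _.
by have := h2 _ _ hw2 hP2; lra.
Qed.

Lemma Delta_lt_matching n q p (eps : R) : Delta n q p < eps ->
  exists s : 'S_n, forall i : 'I_n, normc ((zeros q)`_i - (zeros p)`_(s i)) < eps.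
Proof.
rewrite /Delta; set S := (X in seq_min X) => hS.
have [|/mapP[s _ sE] _] := @seq_minP R S.
  rewrite -size_eq0 size_map -cardE -lt0n; apply/card_gt0P.
  by exists (1%g : 'S_n).
exists s => i; apply: le_lt_trans hS; rewrite sE.
set T := (X in seq_max X).
have iT : normc ((zeros q)`_i - (zeros p)`_(s i)) \in T.
  by apply: map_f; rewrite mem_enum.
by have [|_] := @seq_maxP R T; [case: (T) iT | apply].
Qed.

Lemma prod_zeros n q : size q = n.+1 -> q \is monic ->
  q = \prod_(i < n) ('X - ((zeros q)`_i)%:P).
Proof.
move=> sq mq; rewrite {1}(zeros_spec q) (monicP mq) scale1r.
by rewrite (big_nth 0) size_zeros ?monic_neq0// sq big_mkord.
Qed.

(** If all critical points of [q] were at distance at least eta from [w], then |q'(w)| >= n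
    eta^(n-1); but p'(w) = 0 and q'(w) is close to p'(w). *)
Lemma crit_near n p (w : R[i]) (eta : R) :
  (0 < n)%N -> size p = n.+1 -> p \is monic -> root p^`() w -> 0 < eta ->
  exists2 delta : R, 0 < delta & forall q,
    size q = n.+1 -> q \is monic -> Delta n q p < delta ->
    exists2 w', root q^`() w' & normc (w - w') < eta.
Proof.
move=> n0 sp mp rw eta0.
have e0 : 0 < n%:R * eta ^+ n.-1 by rewrite mulr_gt0 ?ltr0n ?exprn_gt0.
have [d d0 h] := prod_XsubC_near (fun i : 'I_n => (zeros p)`_i) w e0.
exists d => // q sq mq /Delta_lt_matching[s hs].
(* The matching sends indices of [q] to indices of [p]; its inverse lists the zeros of [q] in the
   order of those of [p]. *)
have [|_] := h (fun i => (zeros q)`_((s^-1)%g i)).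
  by move=> i; have := hs ((s^-1)%g i); rewrite permKV normc_distC.
have qE : q = \prod_(i < n) ('X - ((zeros q)`_((s^-1)%g i))%:P).
  by rewrite {1}(prod_zeros sq mq) (reindex_inj (@perm_inj _ (s^-1)%g)).
rewrite -qE -(prod_zeros sp mp) (rootP rw) sub0r normc_opp (normc_deriv w sq mq n0).
have [_ _ sz mz] := deriv_zeros sq mq n0.
rewrite ltr_pM2l ?ltr0n// => hlt; apply: contrapT => hno.
move: hlt; rewrite ltNge => /negP; apply; rewrite -sz.
apply: prod_ge_exp => [|w']; first exact: ltW.
by rewrite mz => rw'; rewrite leNgt; apply/negP => lt; apply: hno; exists w'.
Qed.

Lemma uniform_radius (T : finType) (P : T -> R -> Prop) :
  (forall j d e, P j d -> e <= d -> P j e) ->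
  (forall j, exists2 d, 0 < d & P j d) ->
  exists2 d, 0 < d & forall j, P j d.
Proof.
move=> mono ex.
have [d d0 h] : exists2 d, 0 < d & forall j, j \in enum T -> P j d.
  elim: (enum T) => [|i s [d d0 h]]; first by exists 1.
  have [e e0 he] := ex i; exists (Num.min d e); first by rewrite lt_min d0.
  move=> j; rewrite inE => /predU1P[->|/h hj].
    by apply: mono he _; rewrite ge_min lexx orbT.
  by apply: mono hj _; rewrite ge_min lexx.
by exists d => // j; apply: h; rewrite mem_enum.
Qed.

Lemma inM_perturb n p : (4 <= n)%N -> inM n p ->
  exists2 eps : R, 0 < eps & forall q, inS0 n q -> Delta n q p < eps ->
    forall z, root q z -> z != 0 ->
    exists2 w, root q^`() w & normc (z - w) < crit_radius n.
Proof.
move=> n4 hp; have hn : (2 <= n)%N by lia.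
have n0 : (0 < n)%N by lia.
have [sp mp] := inM_size_monic hn hp; have p0 := monic_neq0 mp.
(* The first conjunct keeps the zero 0 of [q] from being matched with a nonzero zero of [p]. *)
pose P (j : 'I_n) (d : R) := (zeros p)`_j != 0 ->
  d <= normc (zeros p)`_j /\ forall q z, size q = n.+1 -> q \is monic ->
    Delta n q p < d -> normc (z - (zeros p)`_j) < d ->
    exists2 w, root q^`() w & normc (z - w) < crit_radius n.
have [j d e hd ed nz|j|eps eps0 h] := @uniform_radius _ P.
- have [h1 h2] := hd nz; split; first exact: le_trans h1.
  by move=> q z ? ? ? ?; apply: h2 => //; exact: lt_le_trans ed.
- have [z0|nz] := eqVneq (zeros p)`_j 0; first by exists 1 => //; rewrite /P z0 eqxx.
  have rj : root p (zeros p)`_j.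
    by rewrite -mem_zeros// mem_nth// size_zeros// sp /=.
  have [w rw hw] := inM_crit n4 hp rj nz.
  (* Half of the slack absorbs the move of the zero, the other half that of the critical point. *)
  pose gap := (crit_radius n - normc ((zeros p)`_j - w)) / 2.
  have gap0 : 0 < gap by rewrite divr_gt0// subr_gt0.
  have [d d0 hd] := crit_near n0 sp mp rw gap0.
  exists (Num.min (normc (zeros p)`_j) (Num.min gap d)).
    by rewrite !lt_min gap0 d0 normc_gt0 nz.
  move=> _; split; first by rewrite ge_min lexx.
  move=> q z sq mq; rewrite !lt_min => /and3P[_ _ Dd] /and3P[_ zg _].
  have [w' rw' ww'] := hd q sq mq Dd; exists w' => //.
  have := normc_dist_trans (zeros p)`_j z w'.
  have := normc_dist_trans w (zeros p)`_j w'.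
  by rewrite /gap in zg ww'; lra.
exists eps => // q [mq sq _ rq0] Dq z rz z0.
have q0 := monic_neq0 mq.
have [s hs] := Delta_lt_matching Dq.
have index x : root q x -> exists i : 'I_n, (zeros q)`_i = x.
  rewrite -mem_zeros//; case/(nthP (0 : R[i])) => i; rewrite size_zeros// sq /= => ilt <-.
  by exists (Ordinal ilt).
have [i zi] := index z rz; have [i0 z0i] := index 0 rq0.
have hi := hs i; rewrite zi in hi.
have [zs|nz] := eqVneq (zeros p)`_(s i) 0; last first.
  by have [_ H] := h (s i) nz; exact: H hi.
have hi0 := hs i0; rewrite z0i sub0r normc_opp in hi0.
have [zs0|nz] := eqVneq (zeros p)`_(s i0) 0; last first.
  by have [H _] := h (s i0) nz; move: hi0; rewrite ltNge H.
(* Otherwise [z] and 0, which sit at distinct indices, would both be matched with 0, making 0 a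
   multiple zero of [p]. *)
have [g pE g0] := inM_simple0 hn hp.
have [si|si] := eqVneq (s i) (s i0).
  by move: z0; rewrite -zi (perm_inj si) z0i eqxx.
case/negP: g0; have := prod_zeros sp mp.
rewrite (bigD1 (s i))//= (bigD1 (s i0)) 1?eq_sym//= zs zs0 subr0 {1}pE.
move=> /(mulfI (negbT (polyX_eq0 _))) ->.
by rewrite hornerM hornerX mul0r.
Qed.

Lemma crit_close_or_inM n p : (2 <= n)%N -> inM n p ->
  exists2 eps : R, 0 < eps & forall q, inS0 n q -> Delta n q p < eps ->
    forall z, root q z -> z != 0 ->
    (exists2 w, root q^`() w & normc (z - w) < crit_radius n) \/
    (inM n q /\ exists2 w, root q^`() w & normc (z - w) <= crit_radius n).
Proof.
move=> hn hp; have [n4|n4] := leqP 4 n.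
  have [eps eps0 h] := inM_perturb n4 hp.
  by exists eps => // q hq Dq z rz z0; left; exact: h Dq z rz z0.
(* In degrees 2 and 3 the dichotomy holds on all of S(n,0), so any radius will do. *)
exists 1 => // q hq _ z rz z0.
have [e|e] : n = 2%N \/ n = 3%N by lia.
  by subst n; exact: quadratic_crit.
by subst n; exact: cubic_crit.
Qed.

End Perturbation.

Theorem proposition1 (R : realType) (n : nat) (hn : (2 <= n)%N)
    (p : {poly R[i]}) (hp : inM n p) :
  exists2 eps : R, 0 < eps &
    forall q : {poly R[i]}, inS0 n q -> Delta n q p < eps ->
      d q <= (n%:R^-1) `^ ((n.-1)%:R^-1) /\
      (~ inM n q -> d q < (n%:R^-1) `^ ((n.-1)%:R^-1)).
Proof.
rewrite -/(crit_radius n).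
have [eps eps0 h] := crit_close_or_inM hn hp.
exists eps => // q hq Dq; have [mq sq _ _] := hq.
have sq1 : (1 < size q)%N by rewrite sq; lia.
have [q'0 _ _ _] := deriv_zeros sq mq (ltnW hn).
split.
  apply: d_le => // z rz; have [->|z0] := eqVneq z 0.
    have [w rw hw] := inS0_crit_le hn hq; exists w => //.
    by rewrite sub0r normc_opp.
  have [[w rw /ltW hw]|[_ //]] := h q hq Dq z rz z0.
  by exists w.
move=> nM; apply: d_lt => // z rz; have [->|z0] := eqVneq z 0; last first.
  by have [//|[]] := h q hq Dq z rz z0.
(* Strictness can fail at 0 only when no critical point is closer than the radius, and this extremal
   case puts [q] in M_n. *)
apply: contrapT => hno; apply: nM.
have [|H1 H2] := inS0_extremal hn hq; last exact: extremal_inM.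
move=> w rw; rewrite leNgt; apply/negP => lt; apply: hno; exists w => //.
by rewrite sub0r normc_opp.
Qed.
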